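(* Consider the infinite system of ordinary differential equations $$\frac{d}{dt}c_1(t)=-2c_1(t)+\sum_{k\ge1}(k-1)k\,c_k(t),$$ $$\frac{d}{dt}c_k(t)=-2c_k(t)-(k-1)c_k(t)+\frac1{m_0(c(t))}\sum_{i=1}^{k-1}c_i(t)c_{k-i}(t)\qquad(k\ge2),$$ where $m_0(c)=\sum_{k\ge1}c_k$. This system admits a unique steady state $c=(c_k)_{k\ge1}$, in the sense that there is a unique sequence with $c_k\ge0$ for all $k\ge1$, $\sum_{k\ge1}kc_k=1$, and $$2c_1=\sum_{k\ge1}(k-1)k\,c_k,\qquad (k+1)c_k=\frac1{m_0(c)}\sum_{i=1}^{k-1}c_ic_{k-i}\quad(k\ge2).$$ This steady state is given by $c_k=a_k\,g^{k-1}2^{-k}$, where $a_1=1$ and, for $k\ge2$, $a_k=\frac1{k+1}\sum_{j=1}^{k-1}a_ja_{k-j}$, while $g>0$ is the unique solution of $\sum_{k\ge1}a_k(g/2)^k=1$. Moreover $c_1=1/2$, $\sum_{k\ge1}k^2c_k=2$ and $m_0(c)=1/g$.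
   Context: All sequences are indexed by integers $k\ge1$ and are real valued. *)

(* Defs.v *)
From HB Require Import structures.
From mathcomp Require Import all_boot all_order all_algebra.
From mathcomp Require Import all_classical all_reals all_analysis.
From mathcomp Require Import ring lra.

Set Implicit Arguments.
Unset Strict Implicit.
Unset Printing Implicit Defensive.

Import Order.TTheory GRing.Theory Num.Theory.
Import numFieldNormedType.Exports.

Local Open Scope classical_set_scope.
Local Open Scope ring_scope.

(* A real sequence (u_k)_{k >= 1} is represented by a function [nat -> R] whose
   value at 0 is never used; equality of two sequences means equality at every
   k >= 1. *)

Definition partial_sum (R : realType) (u : nat -> R) : nat -> R :=
  fun n => \sum_(1 <= k < n) u k.

(* The series \sum_{k >= 1} u_k converges in R and has sum l. *)
Definition has_sum (R : realType) (u : nat -> R) (l : R) : Prop :=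
  partial_sum u @ \oo --> l.

(* Only meaningful when the series converges; this follows from the
   convergence of \sum_k k c_k when c >= 0. *)
Definition m0 (R : realType) (c : nat -> R) : R := limn (partial_sum c).

Record steady_state (R : realType) (c : nat -> R) : Prop := SteadyState {
  steady_ge0 : forall k, (1 <= k)%N -> 0 <= c k;
  steady_mass : has_sum (fun k => k%:R * c k) 1;
  steady_eq1 : has_sum (fun k => (k%:R - 1) * k%:R * c k) (2 * c 1%N);
  steady_eq : forall k, (2 <= k)%N ->
    (k%:R + 1) * c k = 1 / m0 c * \sum_(1 <= i < k) c i * c (k - i)%N
}.

Definition ode_solution (R : realType) (c : R -> nat -> R) : Prop :=
  forall t : R, 0 < t ->
  [/\ cvgn (partial_sum (c t)),
      (exists2 s : R, has_sum (fun k => (k%:R - 1) * k%:R * c t k) s &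
         is_derive t 1 (fun u => c u 1%N) (- 2 * c t 1%N + s)) &
      forall k, (2 <= k)%N ->
        is_derive t 1 (fun u => c u k)
          (- 2 * c t k - (k%:R - 1) * c t k +
           1 / m0 (c t) * \sum_(1 <= i < k) c t i * c t (k - i)%N)].

Lemma has_sum_le_cvg (R : realType) (u v : nat -> R) (l : R) :
  (forall k, (1 <= k)%N -> 0 <= u k <= v k) -> has_sum v l ->
  cvgn (partial_sum u).
Proof.
move=> uv vl.
have v0 k : (1 <= k)%N -> 0 <= v k by move=> /uv /andP[/le_trans]; exact.
have mono (w : nat -> R) : (forall k, (1 <= k)%N -> 0 <= w k) ->
    nondecreasing_seq (partial_sum w).
  move=> w0; apply/nondecreasing_seqP => n; rewrite /partial_sum.
  case: n => [|n]; first by rewrite !big_geq.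
  by rewrite [leRHS]big_nat_recr//= lerDl w0.
apply: nondecreasing_is_cvgn; first by apply: mono => k /uv /andP[].
exists l => _ [n _ <-].
have vn : partial_sum v n <= l.
  by rewrite -(cvg_lim _ vl)//; apply: nondecreasing_cvgn_le;
    [exact: mono | apply/cvg_ex; exists l].
apply: le_trans vn; rewrite /partial_sum !big_nat.
by apply: ler_sum => k /andP[/uv /andP[]].
Qed.

(* The steady states are the constant-in-time solutions that are nonnegative
   and satisfy \sum_k k c_k = 1. *)
Lemma steady_state_ode (R : realType) (c : nat -> R) :
  steady_state c <->
  [/\ forall k, (1 <= k)%N -> 0 <= c k, has_sum (fun k => k%:R * c k) 1
    & ode_solution (fun _ : R => c)].
Proof.
split=> [[c0 cm c1 ck]|[c0 cm co]].
- split=> // t _; split.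
  + apply: has_sum_le_cvg cm => k k1; rewrite c0//=.
    by rewrite ler_peMl ?c0// ler1n.
  + exists (2 * c 1%N); first exact: c1.
    by rewrite mulNr addNr; exact: is_derive_cst.
  + move=> k k2; rewrite -ck//.
    have -> : - 2 * c k - (k%:R - 1) * c k + (k%:R + 1) * c k = 0.
      rewrite -mulNr -!mulrDl opprB addrACA -addrA.
      by rewrite [X in X * _](_ : _ = 0) ?mul0r//; ring.
    exact: is_derive_cst.
- have [_ [s hs ds] dk] := co 1 ltr01.
  split=> //.
  + have := @derive_val _ _ _ _ _ _ _ ds; rewrite derive_cst => /esym/eqP.
    by rewrite mulNr addrC subr_eq0 => /eqP <-.
  + move=> k /dk dkk.
    have := @derive_val _ _ _ _ _ _ _ dkk; rewrite derive_cst => /eqP.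
    rewrite eq_sym addrC addr_eq0 => /eqP ->; ring.
Qed.

(* The list [:: a_0; ...; a_(n-1)], with the dummy value a_0 = 0. *)
Fixpoint acoef_table (R : realType) (n : nat) : seq R :=
  if n is m.+1 then
    let s := acoef_table R m in
    rcons s (if (m <= 1)%N then m%:R
             else 1 / (m%:R + 1) * \sum_(1 <= j < m) s`_j * s`_(m - j))
  else [::].

Definition acoef (R : realType) (k : nat) : R := (acoef_table R k.+1)`_k.

Lemma size_acoef_table (R : realType) n : size (acoef_table R n) = n.
Proof. by elim: n => //= n IHn; rewrite size_rcons IHn. Qed.

Lemma nth_acoef_table (R : realType) n k :
  (k < n)%N -> (acoef_table R n)`_k = acoef R k.
Proof.
elim: n => // n IHn; rewrite ltnS leq_eqVlt => /predU1P[->//|kn].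
by rewrite /= nth_rcons size_acoef_table kn IHn.
Qed.

Lemma acoef1 (R : realType) : acoef R 1 = 1.
Proof. by []. Qed.

Lemma acoefE (R : realType) k : (2 <= k)%N ->
  acoef R k = 1 / (k%:R + 1) * \sum_(1 <= j < k) acoef R j * acoef R (k - j).
Proof.
move=> k2; rewrite {1}/acoef /= nth_rcons size_acoef_table ltnn eqxx.
rewrite leqNgt k2 /=; congr (_ * _); rewrite !big_nat; apply: eq_bigr => j.
move=> /andP[j1 jk]; rewrite !nth_acoef_table// ltn_subrL j1.
exact: leq_trans k2.
Qed.

(* Main.v *)
Require Import Defs.
From mathcomp Require Import all_boot all_order all_algebra.
From mathcomp Require Import all_classical all_reals all_analysis.
From mathcomp Require Import ring lra.

(** Let A(x) be the sum over k >= 1 of a_k x^k.  Multiplying the recursion of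
the a_k by x^k and summing gives, for a nonnegative x at which the series
converges,

  M1(x) + A(x) = A(x)^2 + 2 x,       where Mp(x) = sum_k k^p a_k x^k,

because the recursion holds for every k >= 2 and the term k = 1 contributes
2 x; multiplying by k before summing gives

  M2(x) + M1(x) = 2 M1(x) A(x) + 2 x.

Hence, once a point x > 0 with A(x) = 1 is known, M1(x) = 2 x and
M2(x) = 4 x ([gterm_moment1], [gterm_moment2]); with g = 2 x all the claims on
c_k = a_k x^k / (2 x) are read off from A, M1 and M2 ([steady_state_gterm]).
A steady state c conversely satisfies c_k = m a_k (c_1 / m)^k with m = m0 c
([steady_stateE]); summing gives A(c_1 / m) = 1, so c_1 / m = x since A is
strictly increasing, and then the mass condition fixes m.

The main point is that A takes the value 1 while its series still converges
([gterm_sum1]).  Rather than studying the singularity of A, one works with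
the partial sums P_n, whose roots r_n of P_n = 1 decrease to some x >= 1/2.
Truncating the first identity turns it into the inequality
sum_(k<n) (k + 1) a_k r_n^k <= P_n(r_n)^2 + 2 r_n, so that
sum_(k<n) k a_k r_n^k <= 2 r_n uniformly in n; by convexity
1 - P_n(x) <= 2 (r_n - x), which tends to 0. *)

Set Implicit Arguments.
Unset Strict Implicit.
Unset Printing Implicit Defensive.

Import Order.TTheory GRing.Theory Num.Theory.
Import numFieldNormedType.Exports.

Local Open Scope classical_set_scope.
Local Open Scope ring_scope.

(** * Series of nonnegative terms and their Cauchy products *)

Section Series.
Variable R : realType.
Implicit Types (u v : nat -> R) (l b : R).

Lemma partial_sumS u n : (1 <= n)%N ->
  partial_sum u n.+1 = partial_sum u n + u n.
Proof. by move=> n1; rewrite /partial_sum big_nat_recr. Qed.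

Lemma eq_partial_sum u v n : (forall k, (1 <= k)%N -> u k = v k) ->
  partial_sum u n = partial_sum v n.
Proof.
move=> uv; rewrite /partial_sum !big_nat.
by apply: eq_bigr => k /andP[/uv].
Qed.

Lemma eq_has_sum u v l : (forall k, (1 <= k)%N -> u k = v k) ->
  has_sum u l -> has_sum v l.
Proof.
move=> uv; rewrite /has_sum (_ : partial_sum u = partial_sum v)//.
by apply/funext => n; exact: eq_partial_sum.
Qed.

Lemma has_sum_unique u l b : has_sum u l -> has_sum u b -> l = b.
Proof. by move=> ul ub; rewrite -(cvg_lim _ ul)// -(cvg_lim _ ub). Qed.

Lemma has_sum_m0 u l : has_sum u l -> m0 u = l.
Proof. exact: cvg_lim. Qed.

Lemma has_sumD u v l b : has_sum u l -> has_sum v b ->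
  has_sum (fun k => u k + v k) (l + b).
Proof.
move=> ul vb; rewrite /has_sum.
have -> : partial_sum (fun k => u k + v k) =
    (fun n => partial_sum u n + partial_sum v n).
  by apply/funext => n; rewrite /partial_sum big_split.
exact: cvgD.
Qed.

Lemma has_sumZ a u l : has_sum u l -> has_sum (fun k => a * u k) (a * l).
Proof.
move=> ul; rewrite /has_sum.
have -> : partial_sum (fun k => a * u k) = (fun n => a * partial_sum u n).
  by apply/funext => n; rewrite /partial_sum mulr_sumr.
exact: cvgMl_tmp.
Qed.

Lemma has_sum_first b : has_sum (fun k => if k == 1%N then b else 0) b.
Proof.
rewrite /has_sum -(cvg_shiftn 2).
rewrite (_ : (fun _ => _) = fun=> b); first exact: cvg_cst.
apply/funext => n; rewrite addn2 /partial_sum big_ltn// big_nat big1 ?addr0//.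
by move=> [|[|k]].
Qed.

Lemma has_sum_le u l b : has_sum u l -> (forall n, partial_sum u n <= b) ->
  l <= b.
Proof.
move=> ul ub; rewrite -(cvg_lim _ ul)//; apply: limr_le.
  by apply/cvg_ex; exists l.
by apply: nearW => n; exact: ub.
Qed.

Lemma partial_sum_homo u : (forall k, (1 <= k)%N -> 0 <= u k) ->
  {homo partial_sum u : m n / (m <= n)%N >-> m <= n}.
Proof.
move=> u0; apply/nondecreasing_seqP => -[|n].
  by rewrite /partial_sum !big_geq.
by rewrite [leRHS]partial_sumS// lerDl u0.
Qed.

Lemma partial_sum_le_has_sum u l n : (forall k, (1 <= k)%N -> 0 <= u k) ->
  has_sum u l -> partial_sum u n <= l.
Proof.
move=> u0 ul; rewrite -(cvg_lim _ ul)//; apply: nondecreasing_cvgn_le.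
  exact: partial_sum_homo.
by apply/cvg_ex; exists l.
Qed.

Lemma has_sum_bounded u b : (forall k, (1 <= k)%N -> 0 <= u k) ->
  (forall n, partial_sum u n <= b) -> exists l, has_sum u l.
Proof.
move=> u0 ub; apply/cvg_ex; apply: nondecreasing_is_cvgn.
  exact: partial_sum_homo.
by exists b => _ [n _ <-].
Qed.

Definition conv u v k := \sum_(1 <= i < k) u i * v (k - i)%N.

(** Summing over triangles column by column: for a fixed i, the indices of v
that meet u i in the first n diagonals are those below n - i. *)
Lemma partial_sum_conv u v n :
  partial_sum (conv u v) n = \sum_(1 <= i < n) u i * partial_sum v (n - i).
Proof.
elim: n => [|[|n] IHn].
- by rewrite /partial_sum !big_geq.
- by rewrite /partial_sum !big_geq.
rewrite partial_sumS// IHn [RHS]big_nat_recr//= subSnn.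
rewrite [partial_sum v 1]big_geq// mulr0 addr0.
rewrite -big_split/= !big_nat; apply: eq_bigr => i /andP[_ iN].
by rewrite (subSn (ltnW iN)) partial_sumS ?subn_gt0// mulrDr.
Qed.

Lemma partial_sum_conv_le u v n : (forall k, (1 <= k)%N -> 0 <= u k) ->
  (forall k, (1 <= k)%N -> 0 <= v k) ->
  partial_sum (conv u v) n <= partial_sum u n * partial_sum v n.
Proof.
move=> u0 v0; rewrite partial_sum_conv [partial_sum u n]/partial_sum mulr_suml.
rewrite !big_nat; apply: ler_sum => i /andP[i1 _].
apply: ler_wpM2l; first exact: u0.
by apply: partial_sum_homo => //; exact: leq_subr.
Qed.

Lemma partial_sum_conv_ge u v n : (forall k, (1 <= k)%N -> 0 <= u k) ->
  (forall k, (1 <= k)%N -> 0 <= v k) ->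
  partial_sum u n * partial_sum v n <= partial_sum (conv u v) (n + n).
Proof.
move=> u0 v0; case: n => [|n]; first by rewrite /partial_sum !big_geq// mul0r.
rewrite partial_sum_conv (@big_cat_nat _ _ _ n.+1)//= ?leq_addr//.
rewrite {1}/partial_sum mulr_suml.
apply: ler_wpDr.
  rewrite big_nat sumr_ge0// => i /andP[ni _]; apply: mulr_ge0.
    exact/u0/(leq_trans _ ni).
  by rewrite /partial_sum big_nat sumr_ge0// => k /andP[/v0].
rewrite !big_nat; apply: ler_sum => i /andP[i1 iN].
apply: ler_wpM2l; first exact: u0.
by apply: partial_sum_homo => //; rewrite -addnBA ?leq_addr// ltnW.
Qed.

(** The partial sums of the product series are trapped between products of
partial sums: U_n V_n <= W_2n and W_n <= U_n V_n, where U, V, W are the partial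
sums of u, v and conv u v. *)
Lemma has_sum_conv u v l b : (forall k, (1 <= k)%N -> 0 <= u k) ->
  (forall k, (1 <= k)%N -> 0 <= v k) ->
  has_sum u l -> has_sum v b -> has_sum (conv u v) (l * b).
Proof.
move=> u0 v0 ul vb.
have c0 k : (1 <= k)%N -> 0 <= conv u v k.
  move=> k1; rewrite /conv big_nat sumr_ge0// => i /andP[i1 ik].
  by rewrite mulr_ge0 ?u0 ?v0// subn_gt0.
have uvlb : (fun n => partial_sum u n * partial_sum v n) @ \oo --> l * b.
  exact: cvgM.
have ps0 w n : (forall k, (1 <= k)%N -> 0 <= w k) -> 0 <= partial_sum w n.
  by move=> w0; rewrite /partial_sum big_nat sumr_ge0// => k /andP[/w0].
have cb n : partial_sum (conv u v) n <= l * b.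
  apply: le_trans (partial_sum_conv_le _ u0 v0) _.
  by apply: ler_pM; rewrite ?ps0//; exact: partial_sum_le_has_sum.
have [s cs] := has_sum_bounded c0 cb.
suff <- : s = l * b by [].
apply/le_anti/andP; split; first exact: has_sum_le cs cb.
rewrite -(cvg_lim _ uvlb)//; apply: limr_le.
  by apply/cvg_ex; exists (l * b).
apply: nearW => n; apply: le_trans (partial_sum_conv_ge _ u0 v0) _.
exact: partial_sum_le_has_sum.
Qed.

End Series.

(* [has_sum] unfolds to an inclusion of filters, which would make the scalar
   arguments implicit. *)
Arguments has_sumZ {R} a {u l} ul _ _.
Arguments has_sum_first {R} b _ _.

(** * The generating function of the coefficients *)

Section Coefficients.
Variable R : realType.
Implicit Types x y : R.

Lemma acoef_gt0 k : (1 <= k)%N -> 0 < acoef R k.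
Proof.
elim/ltn_ind: k => -[//|[|k]] IH _; first by rewrite acoef1.
rewrite acoefE// mulr_gt0//.
rewrite big_ltn// ltr_wpDr//.
  rewrite big_nat sumr_ge0// => i /andP[i1 ik].
  by rewrite mulr_ge0 ?ltW// IH ?subn_gt0 ?ltn_subrL ?(ltnW i1).
by rewrite acoef1 mul1r IH.
Qed.

Lemma acoef_le1 k : (1 <= k)%N -> acoef R k <= 1.
Proof.
elim/ltn_ind: k => -[//|[|k]] IH _; first by rewrite acoef1.
rewrite acoefE// div1r mulrC natr1 ler_pdivrMr ?ltr0n// mul1r.
rewrite (@le_trans _ _ (\sum_(1 <= j < k.+2) 1))//.
  rewrite !big_nat; apply: ler_sum => i /andP[i1 ik].
  by rewrite mulr_ile1 ?IH ?ltW ?acoef_gt0 ?subn_gt0 ?ltn_subrL ?i1.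
by rewrite big_const_nat iter_addr_0 -mulr_natr mul1r ler_nat subSS leqW.
Qed.

(** The series A(x) is handled through its sequence of terms, to which [conv]
applies. *)
Definition gterm x k := acoef R k * x ^+ k.

Lemma gterm_ge0 x k : 0 <= x -> (1 <= k)%N -> 0 <= gterm x k.
Proof. by move=> x0 k1; rewrite mulr_ge0 ?exprn_ge0// ltW// acoef_gt0. Qed.

(** The recursion of the coefficients fails at k = 1, where the convolution is
empty and the defect is 2 x; summed over k this is the Riccati equation
x A' + A = A^2 + 2 x. *)
Lemma gterm_recurrence x k : (1 <= k)%N ->
  (k%:R + 1) * gterm x k =
  conv (gterm x) (gterm x) k + (if k == 1%N then 2 * x else 0).
Proof.
move: k => [//|[_|k _]].
  by rewrite /conv big_geq//= /gterm acoef1 expr1; ring.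
rewrite /= addr0 /gterm mulrA acoefE// div1r mulVKf ?natr1 ?pnatr_eq0//.
rewrite /conv mulr_suml !big_nat; apply: eq_bigr => i /andP[i1 ik].
have -> : x ^+ k.+2 = x ^+ i * x ^+ (k.+2 - i) by rewrite -exprD subnKC// ltnW.
by ring.
Qed.

(** The products dropped when the Riccati equation is truncated are
nonnegative, so it survives as an inequality for the partial sums. *)
Lemma gterm_moment_le x n : 0 <= x ->
  partial_sum (fun k => (k%:R + 1) * gterm x k) n <=
  partial_sum (gterm x) n ^+ 2 + 2 * x.
Proof.
move=> x0; rewrite (eq_partial_sum (v := fun k => conv (gterm x) (gterm x) k +
  (if k == 1%N then 2 * x else 0)))//;
  last by move=> k; exact: gterm_recurrence.
rewrite {1}/partial_sum big_split/= -!/(partial_sum _ _) lerD//.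
  by rewrite expr2 partial_sum_conv_le// => k; exact: gterm_ge0.
apply: (partial_sum_le_has_sum _ _ (has_sum_first _)) => k _.
by case: ifP => // _; rewrite mulr_ge0.
Qed.

(** Already the term k = 1 contributes y - x; this is a quantitative form of
strict monotonicity that passes to the limit. The offset in n.+2 makes sure
that this term is present. *)
Lemma partial_sum_gterm_gap x y n : 0 <= x <= y ->
  y - x <= partial_sum (gterm y) n.+2 - partial_sum (gterm x) n.+2.
Proof.
move=> /andP[x0 xy]; rewrite /partial_sum !(@big_ltn _ _ _ 1 n.+2)//.
rewrite /gterm acoef1 !mul1r !expr1.
suff : \sum_(2 <= i < n.+2) acoef R i * x ^+ i <=
       \sum_(2 <= i < n.+2) acoef R i * y ^+ i by lra.
rewrite !big_nat; apply: ler_sum => i /andP[i2 _].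
apply: ler_wpM2l; first by rewrite ltW// acoef_gt0// ltnW.
by rewrite lerXn2r// nnegrE// (le_trans x0).
Qed.

(** Convexity of the power function, multiplied by y so that only y^k occurs
on the right and the case k = 0 needs no exception. *)
Lemma exprn_convex x y k : 0 <= x <= y ->
  y * (y ^+ k - x ^+ k) <= (y - x) * (k%:R * y ^+ k).
Proof.
move=> /andP[x0 xy]; have y0 : 0 <= y by exact: le_trans xy.
elim: k => [|k IHk]; first by rewrite !expr0 subrr mulr0 mul0r mulr0.
have : y * (y * (y ^+ k - x ^+ k)) <= y * ((y - x) * (k%:R * y ^+ k)).
  exact: ler_wpM2l.
have : y * (y - x) * x ^+ k <= y * (y - x) * y ^+ k.
  by rewrite ler_wpM2l ?mulr_ge0 ?subr_ge0// lerXn2r// nnegrE.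
rewrite !exprS -natr1; set a := x ^+ k; set c := y ^+ k; set d := k%:R.
lra.
Qed.

Lemma partial_sum_gterm_convex x y n : 0 <= x <= y ->
  y * (partial_sum (gterm y) n - partial_sum (gterm x) n) <=
  (y - x) * partial_sum (fun k => k%:R * gterm y k) n.
Proof.
move=> xy; rewrite /partial_sum -sumrB !mulr_sumr !big_nat.
apply: ler_sum => k /andP[k1 _]; rewrite /gterm.
have := ler_wpM2l (ltW (acoef_gt0 k1)) (exprn_convex k xy).
by rewrite -mulrBr !(mulrCA _ (acoef R k)).
Qed.

(** As a_k <= 1, comparison with the geometric series at 1/2, whose sum is 1;
this keeps the roots of the partial sums away from 0. *)
Lemma partial_sum_gterm_half n : partial_sum (gterm 2^-1) n <= 1.
Proof.
case: n => [|n]; first by rewrite /partial_sum big_geq.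
suff : partial_sum (gterm 2^-1) n.+1 <= 1 - 2^-1 ^+ n.
  by move/le_trans; apply; rewrite lerBlDr lerDl exprn_ge0// invr_ge0.
elim: n => [|n IHn]; first by rewrite /partial_sum big_geq// expr0 subrr.
rewrite partial_sumS//.
have : gterm 2^-1 n.+1 <= 2^-1 ^+ n.+1.
  by rewrite ler_piMl ?acoef_le1// exprn_ge0// invr_ge0.
by move: IHn; rewrite exprS; set a := 2^-1 ^+ n; lra.
Qed.

Lemma partial_sum_gterm_root n :
  exists x, 2^-1 <= x <= 1 /\ partial_sum (gterm x) n.+2 = 1.
Proof.
pose p : {poly R} := \sum_(1 <= k < n.+2) acoef R k *: 'X^k - 1.
have pE x : p.[x] = partial_sum (gterm x) n.+2 - 1.
  rewrite hornerD hornerN hornerC horner_sum; congr (_ - _).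
  by apply: eq_bigr => k _; rewrite hornerZ hornerXn.
have [||x x01 /rootP px] := @poly_ivt _ p 2^-1 1; first by lra.
  rewrite !pE subr_le0 subr_ge0 partial_sum_gterm_half/=.
  rewrite /partial_sum big_ltn// /gterm acoef1 expr1 mul1r lerDl.
  by rewrite big_nat sumr_ge0// => i /andP[i2 _]; exact/gterm_ge0/ltnW.
by exists x; split=> //; apply/eqP; rewrite -subr_eq0 -pE px.
Qed.

(** The roots r n of P_(n+2) = 1 decrease to a limit x. The truncated Riccati
inequality at r n, where the partial sum equals 1, bounds the first moment by
2 (r n), so convexity gives 1 - P_(n+2)(x) <= 2 (r n - x). *)
Lemma gterm_sum1 : exists2 x, 0 < x & has_sum (gterm x) 1.
Proof.
have [r r01] := choice partial_sum_gterm_root.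
have r0 n : 0 < r n by have [/andP[+ _] _] := r01 n; lra.
have moment n : partial_sum (fun k => k%:R * gterm (r n) k) n.+2 <= 2 * r n.
  have := gterm_moment_le n.+2 (ltW (r0 n)); have [_ rn1] := r01 n.
  rewrite rn1 (eq_partial_sum
      (v := fun k => k%:R * gterm (r n) k + gterm (r n) k)).
    rewrite {1}/partial_sum big_split/=.
    by rewrite -!/(partial_sum _ _) rn1; lra.
  by move=> k _; rewrite mulrDl mul1r.
(* P_(n+3) >= P_(n+2) reaches the value 1 no later. *)
have rdec : {homo r : m n / (m <= n)%N >-> n <= m}.
  apply/nonincreasing_seqP => n; rewrite leNgt; apply/negP => rn.
  have /(partial_sum_gterm_gap n) : 0 <= r n <= r n.+1 by rewrite !ltW.
  have [_ rn1] := r01 n; have [_ rn2] := r01 n.+1.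
  have := @partial_sum_homo _ (gterm (r n.+1))
    (fun k => gterm_ge0 (ltW (r0 _))) n.+2 n.+3 (leqnSn _).
  rewrite rn1 rn2; lra.
have rcvg : cvgn r.
  apply: nonincreasing_is_cvgn => //; exists 0 => _ [n _ <-]; exact: ltW.
pose x := limn r.
have x0 : 0 < x.
  apply: (@lt_le_trans _ _ 2^-1); first lra.
  apply: limr_ge => //; apply: nearW => n.
  by have [/andP[]] := r01 n.
have xr n : x <= r n by exact: nonincreasing_cvgn_ge.
exists x => //; rewrite /has_sum -(cvg_shiftn 2).
apply: (@squeeze_cvgr _ _ _ _ (fun n => 1 - 2 * (r n - x)) (fun=> 1)).
- apply: nearW => n; rewrite /= addn2; have [_ rn1] := r01 n.
  have xrn : 0 <= x <= r n by rewrite xr ltW.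
  apply/andP; split; last first.
    by have := partial_sum_gterm_gap n xrn; have := xr n; rewrite rn1; lra.
  have := partial_sum_gterm_convex n.+2 xrn; rewrite rn1 => h.
  suff : r n * (1 - partial_sum (gterm x) n.+2) <= r n * (2 * (r n - x)).
    by rewrite ler_pM2l//; lra.
  apply: le_trans h _.
  rewrite [leRHS](_ : _ = (r n - x) * (2 * r n)); last by ring.
  by rewrite ler_wpM2l// subr_ge0.
- rewrite -[X in _ --> X]subr0 -[X in _ - X](mulr0 2) -[X in 2 * X](subrr x).
  apply: cvgB; first exact: cvg_cst.
  apply: cvgMl_tmp; apply: cvgB => //; exact: cvg_cst.
- exact: cvg_cst.
Qed.

Lemma gterm_sum_inj x y l : 0 < x -> 0 < y ->
  has_sum (gterm x) l -> has_sum (gterm y) l -> x = y.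
Proof.
wlog xy : x y / x <= y.
  by move=> H x0 y0 hx hy; have [xy|/ltW xy] := leP x y; [|symmetry]; exact: H.
move=> x0 y0 hx hy; apply/le_anti; rewrite xy/= -subr_le0.
suff : l <= l - (y - x) by lra.
apply: has_sum_le hx _ => n.
have xy0 : 0 <= x <= y by rewrite xy ltW.
have := partial_sum_gterm_gap n xy0.
have := partial_sum_homo (fun k => gterm_ge0 (ltW x0)) (leqW (leqnSn n)).
have := partial_sum_le_has_sum n.+2 (fun k => gterm_ge0 (ltW y0)) hy.
lra.
Qed.

(** The Riccati equation where A = 1. Convergence of the first moment comes for
free: its terms are combinations of those of a Cauchy product and of A. *)
Lemma gterm_moment1 x : 0 <= x -> has_sum (gterm x) 1 ->
  has_sum (fun k => k%:R * gterm x k) (2 * x).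
Proof.
move=> x0 x1; have t0 k := @gterm_ge0 x k x0.
have := has_sumD (has_sumD (has_sum_conv t0 t0 x1 x1) (has_sum_first (2 * x)))
  (has_sumZ (-1) x1).
rewrite (_ : 1 * 1 + 2 * x + -1 * 1 = 2 * x); last by ring.
by apply: eq_has_sum => k k1; rewrite -gterm_recurrence//; ring.
Qed.

(** The derivative of the Riccati equation where A = 1: multiplying the
recursion by k acts as a derivation on the Cauchy product. *)
Lemma gterm_moment2 x : 0 <= x -> has_sum (gterm x) 1 ->
  has_sum (fun k => k%:R ^+ 2 * gterm x k) (4 * x).
Proof.
move=> x0 x1; have t0 k := @gterm_ge0 x k x0.
have m1 := gterm_moment1 x0 x1.
have kt0 k : (1 <= k)%N -> 0 <= k%:R * gterm x k.
  by move=> k1; rewrite mulr_ge0// t0.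
have := has_sumD (has_sumD (has_sumD (has_sum_conv kt0 t0 m1 x1)
  (has_sum_conv t0 kt0 x1 m1)) (has_sum_first (2 * x))) (has_sumZ (-1) m1).
rewrite (_ : 2 * x * 1 + 1 * (2 * x) + 2 * x + -1 * (2 * x) = 4 * x);
  last by ring.
apply: eq_has_sum => k k1.
(* The Leibniz rule: k = i + (k - i) inside the convolution. *)
have -> : conv (fun i => i%:R * gterm x i) (gterm x) k +
    conv (gterm x) (fun i => i%:R * gterm x i) k =
    k%:R * conv (gterm x) (gterm x) k.
  rewrite /conv -big_split/= mulr_sumr !big_nat.
  apply: eq_bigr => i /andP[_ ik].
  rewrite (natrB _ (ltnW ik)); move: (gterm x i) (gterm x _) => a b.
  by ring.
have -> : (if k == 1%N then 2 * x else 0) =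
    k%:R * (if k == 1%N then 2 * x else 0).
  by case: eqP => [->|_]; rewrite ?mul1r ?mulr0.
by rewrite -mulrDr -gterm_recurrence//; ring.
Qed.

End Coefficients.

(** * Steady states *)

Section SteadyStates.
Variable R : realType.
Implicit Types c : nat -> R.

(** The prefactor 1 / g = 1 / (2 x) normalises the mass, as the first moment of
gterm x is 2 x. *)
Lemma steady_state_gterm x : 0 < x -> has_sum (gterm x) (1 : R) ->
  steady_state (fun k => (2 * x)^-1 * gterm x k).
Proof.
move=> x0 x1; have xn0 : 2 * x != 0 by rewrite mulf_neq0 ?gt_eqF.
have m1 := gterm_moment1 (ltW x0) x1.
have m2 := gterm_moment2 (ltW x0) x1.
split.
- by move=> k k1; rewrite mulr_ge0 ?gterm_ge0 ?invr_ge0 ?mulr_ge0// ltW.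
- have := has_sumZ (2 * x)^-1 m1; rewrite mulVf//.
  by apply: eq_has_sum => k _; rewrite mulrCA.
- have := has_sumZ (2 * x)^-1 (has_sumD m2 (has_sumZ (-1) m1)).
  rewrite [X in has_sum _ X -> _](_ : _ = 2 * ((2 * x)^-1 * gterm x 1)).
    by apply: eq_has_sum => k _; ring.
  by rewrite /gterm acoef1; field; rewrite gt_eqF.
- move=> k k2; rewrite (has_sum_m0 (has_sumZ _ x1)) mulr1 mulrCA.
  rewrite gterm_recurrence ?(ltnW k2)// gtn_eqF// addr0 /conv !mulr_sumr.
  by apply: eq_bigr => i _; field; rewrite gt_eqF.
Qed.

Lemma steady_state_has_sum c : steady_state c -> has_sum c (m0 c).
Proof.
move=> [c0 cm _ _]; apply: has_sum_le_cvg cm => k k1; rewrite c0//=.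
by rewrite ler_peMl ?c0// ler1n.
Qed.

(** If c_1 = 0 then the recursion propagates zeros to all k, against the unit
mass. *)
Lemma steady_state_c1_gt0 c : steady_state c -> 0 < c 1%N.
Proof.
move=> [c0 cm _ ck]; rewrite lt_neqAle c0// andbT eq_sym; apply/eqP => c10.
have cz k : (1 <= k)%N -> c k = 0.
  elim/ltn_ind: k => -[//|[//|k]] IH _.
  have := ck k.+2 isT; rewrite big_nat big1 ?mulr0.
    by move/eqP; rewrite mulf_eq0 natr1 pnatr_eq0 => /eqP.
  by move=> i /andP[i1 ik]; rewrite (IH i)// mul0r.
have /(has_sum_unique cm)/eqP : has_sum (fun k => k%:R * c k) 0.
  have := has_sumZ 0 cm; rewrite mul0r.
  by apply: eq_has_sum => k k1; rewrite cz// !mulr0.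
by rewrite oner_eq0.
Qed.

Lemma steady_state_m0_gt0 c : steady_state c -> 0 < m0 c.
Proof.
move=> sc; apply: lt_le_trans (steady_state_c1_gt0 sc) _.
have := partial_sum_le_has_sum 2 (steady_ge0 sc) (steady_state_has_sum sc).
by rewrite /partial_sum big_nat1.
Qed.

(** The equations for k >= 2 determine c from c_1 and m = m0 c, and are
homogeneous: they reduce to the recursion of a_k under c_k = m a_k y^k with
y = c_1 / m. *)
Lemma steady_stateE c k : steady_state c -> (1 <= k)%N ->
  c k = m0 c * gterm (c 1%N / m0 c) k.
Proof.
move=> sc; have mn0 : m0 c != 0 by rewrite gt_eqF ?steady_state_m0_gt0.
elim/ltn_ind: k => -[//|[|k]] IH k1.
  by rewrite /gterm acoef1; field.
have kn0 : (k.+2%:R + 1 : R) != 0 by rewrite natr1 pnatr_eq0.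
apply: (mulfI kn0); rewrite (steady_eq sc)// mulrCA gterm_recurrence// addr0.
rewrite /conv !mulr_sumr !big_nat; apply: eq_bigr => i /andP[i1 ik].
rewrite (IH i)// (IH (k.+2 - i)%N) ?subn_gt0 ?ltn_subrL ?i1//.
by field.
Qed.

(** Summing [steady_stateE] gives A(c_1 / m) = 1, hence c_1 / m = x; the unit
mass then determines m. *)
Lemma steady_state_unique c x : 0 < x -> has_sum (gterm x) 1 ->
  steady_state c -> forall k, (1 <= k)%N -> c k = (2 * x)^-1 * gterm x k.
Proof.
move=> x0 x1 sc; have m_gt0 := steady_state_m0_gt0 sc.
have y0 : 0 < c 1%N / m0 c by rewrite divr_gt0// steady_state_c1_gt0.
have y1 : has_sum (gterm (c 1%N / m0 c)) 1.
  have := has_sumZ (m0 c)^-1 (steady_state_has_sum sc).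
  rewrite mulVf ?gt_eqF//; apply: eq_has_sum => k k1.
  by rewrite {1}(steady_stateE sc)// mulKf// gt_eqF.
have yx := gterm_sum_inj y0 x0 y1 x1.
have mE : 1 = m0 c * (2 * x).
  apply: has_sum_unique (steady_mass sc) _.
  have := has_sumZ (m0 c) (gterm_moment1 (ltW x0) x1).
  by apply: eq_has_sum => k k1; rewrite (steady_stateE sc k1) yx mulrCA.
move=> k k1; rewrite (steady_stateE sc)// yx; congr (_ * _).
have xn0 : 2 * x != 0 by rewrite mulf_neq0 ?gt_eqF.
by apply: (mulIf xn0); rewrite -mE mulVf.
Qed.

End SteadyStates.

Theorem proposition6p1 (R : realType) :
  exists c : nat -> R,
  [/\ steady_state c,
      (forall c' : nat -> R, steady_state c' ->
         forall k : nat, (1 <= k)%N -> c' k = c k) &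
      exists g : R,
      [/\ 0 < g,
          has_sum (fun k => acoef R k * (g / 2) ^+ k) 1,
          (forall g' : R, 0 < g' ->
             has_sum (fun k => acoef R k * (g' / 2) ^+ k) 1 -> g' = g),
          (forall k : nat, (1 <= k)%N ->
             c k = acoef R k * g ^+ (k - 1) * 2 ^- k) &
          [/\ c 1%N = 1 / 2,
              has_sum (fun k => k%:R ^+ 2 * c k) 2 &
              m0 c = 1 / g]]].
Proof.
have [x x0 x1] := @gterm_sum1 R; have xn0 : x != 0 by rewrite gt_eqF.
exists (fun k => (2 * x)^-1 * gterm x k); split.
- exact: steady_state_gterm.
- by move=> c'; exact: steady_state_unique.
exists (2 * x); split.
- by rewrite mulr_gt0.
- by rewrite mulrC mulKf.
- move=> g' g'0 hg'; have g'2 : 0 < g' / 2 by rewrite divr_gt0.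
  by rewrite -(gterm_sum_inj g'2 x0 hg' x1); field.
- move=> [//|k] _; rewrite subn1 /gterm /= !exprS exprMn.
  by field; rewrite xn0 expf_neq0.
- split.
  + by rewrite /gterm acoef1; field.
  + have := has_sumZ (2 * x)^-1 (gterm_moment2 (ltW x0) x1).
    rewrite (_ : (2 * x)^-1 * (4 * x) = 2); last by field.
    by apply: eq_has_sum => k _; rewrite mulrCA.
  + by rewrite (has_sum_m0 (has_sumZ _ x1)) mulr1 div1r.
Qed.
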